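(* Let $s,t\ge1$ and $n\ge1$ be integers and let $G=([n],[n'],E)$ be the type-$(s,t)$ bipartite graph. Let $1\le i\le n$ and suppose that the vertices $1,2,\dots,i-1$ have been matched by the sequential algorithm run in the top-down order. If $i-s\ge1$ and $(i-s)'$ has not yet been matched, then $J_i=\{(i-s)'\}$. Otherwise, $J_i$ contains all remaining edges incident to $i$, i.e. all edges $(i,k')\in E$ such that $k'$ has not been matched to any of $1,\dots,i-1$.
   Context: Type-$(s,t)$ graph: the bipartite graph with left vertices $[n]=\{1,\dots,n\}$, right vertices $[n']=\{1',\dots,n'\}$, and an edge between $i$ and $j'$ ($1\le i,j\le n$) if and only if $-s\le j-i\le t$. Sequential algorithm (top-down order): start with the empty matching $\pi_0$. For $i=1,2,\dots,n$ in order, let $J_i$ be the set of edges $e$ from vertex $i$ to a not-yet-matched right vertex such that removing $e$ and its end vertices (in addition to all previously matched vertices) leaves a graph having a perfect matching; choose $e\in J_i$ uniformly at random and set $\pi_i=\pi_{i-1}\cup\{e\}$. An edge $(i,k')$ in $J_i$ is identified with its right endpoint $k'$, so $J_i$ is also regarded as a set of right vertices. *)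

(* Defs.v *)
From HB Require Import structures.
From mathcomp Require Import all_boot all_order all_algebra.
Set Implicit Arguments.
Unset Strict Implicit.
Unset Printing Implicit Defensive.
Import Order.TTheory GRing.Theory Num.Theory.
Local Open Scope ring_scope.

(* Vertices are numbered from 0: the ordinal x : 'I_n stands for the vertex   *)
(* x + 1 of {1, .., n}.  The pair (x, y) is the edge between the left vertex  *)
(* x and the right vertex y'.                                                 *)
Definition edge (n : nat) : finType := ('I_n * 'I_n)%type.

(* The difference of the two indices is unaffected by the shift, and is taken *)
(* in int so that it is not truncated.                                        *)
Definition st_graph (s t n : nat) : {set edge n} :=
  [set e : edge n | - s%:Z <= (e.2 : nat)%:Z - (e.1 : nat)%:Z <= t%:Z].

Section SequentialAlgorithm.
Variable n : nat.
Implicit Types (G M pi : {set edge n}) (v : 'I_n).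

Definition lefts M : {set 'I_n} := [set e.1 | e in M].
Definition rights M : {set 'I_n} := [set e.2 | e in M].

Definition matching M : bool :=
  [forall e in M, forall f in M, (e.1 == f.1) || (e.2 == f.2) ==> (e == f)].

Definition perfect_matching G (A B : {set 'I_n}) M : bool :=
  [&& M \subset G, matching M, lefts M == A & rights M == B].

(* The subgraph of G left after deleting all end vertices of pi has a perfect *)
(* matching.                                                                  *)
Definition completable G pi : bool :=
  [exists M : {set edge n}, perfect_matching G (~: lefts pi) (~: rights pi) M].

(* The set J_v when pi is the current partial matching, as a set of edges and *)
(* as a set of right vertices.                                                *)
Definition J G pi v : {set edge n} :=
  [set e in G | [&& e.1 == v, e.2 \notin rights pi & completable G (e |: pi)]].
Definition J_right G pi v : {set 'I_n} := rights (J G pi v).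

(* Law of the partial matching after processing v, from its law mu before: an *)
(* edge of J_v is drawn uniformly and added.  When G has a perfect matching,  *)
(* no J_v met along the algorithm is empty, so that total mass is preserved.  *)
Definition step G (mu : {ffun {set edge n} -> rat}) v :
    {ffun {set edge n} -> rat} :=
  [ffun pi' => \sum_pi mu pi *
     (\sum_(e in J G pi v) (pi' == e |: pi)%:R / #|J G pi v|%:R)].

Definition start : {ffun {set edge n} -> rat} := [ffun pi => (pi == set0)%:R].

(* Law of pi_m, the first m left vertices being processed in increasing order *)
Definition top_down_law G (m : nat) : {ffun {set edge n} -> rat} :=
  foldl (step G) start (take m (enum 'I_n)).

End SequentialAlgorithm.

(* Main.v *)
Require Import Defs.
From HB Require Import structures.
From mathcomp Require Import all_boot all_order all_algebra.
From mathcomp Require Import zify.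
Set Implicit Arguments.
Unset Strict Implicit.
Unset Printing Implicit Defensive.
Import Order.TTheory GRing.Theory Num.Theory.
Local Open Scope ring_scope.

(** Once the left vertices below [m] are matched, with the partial matching
    [pi] as result, whether [pi] extends to a perfect matching is decided by the
    lower end of the band alone: it does if and only if every free right vertex
    [y] satisfies [m <= y + s] (lemma [completableE]).

    The condition is necessary because the partner of [y] will be some
    [x >= m] with [x <= y + s].  It is sufficient because of the greedy choice:
    match [m] to the smallest free right vertex [y].  As only [m] right vertices
    are used, [y <= m], so the upper end of the band is respected; the condition
    gives the lower end; and every other free right vertex exceeds [y], so
    that the condition holds again for [m + 1].

    The theorem follows by comparing the conditions for [m = i] and
    [m = i + 1].  The partial matching reached by the algorithm is completable,
    so every free [y] has [i <= y + s].  After adding [(i, k)], every free [y]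
    other than [k] must satisfy [i < y + s].  Hence a free vertex [i - s], being
    the only one with [i = y + s], has to be taken now, and can be; if it is not
    free, no choice of [k] violates the condition. *)

(** * Matchings as sets of edges *)

Section Matchings.
Variable n : nat.
Implicit Types (G M pi : {set edge n}) (e f : edge n).

Lemma in_lefts M e : e \in M -> e.1 \in lefts M.
Proof. by move=> eM; apply/imsetP; exists e. Qed.

Lemma in_rights M e : e \in M -> e.2 \in rights M.
Proof. by move=> eM; apply/imsetP; exists e. Qed.

Lemma lefts_setU1 M e : lefts (e |: M) = e.1 |: lefts M.
Proof. by rewrite /lefts imsetU1. Qed.

Lemma rights_setU1 M e : rights (e |: M) = e.2 |: rights M.
Proof. by rewrite /rights imsetU1. Qed.

Lemma matchingP M :
  reflect {in M &, forall e f, (e.1 = f.1) \/ (e.2 = f.2) -> e = f}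
          (matching M).
Proof.
apply: (iffP forall_inP) => [mM e f eM fM ef | mM e eM].
  have /forall_inP/(_ f fM)/implyP H := mM e eM.
  by apply/eqP/H/orP; case: ef => ->; rewrite eqxx; [left | right].
apply/forall_inP => f fM; apply/implyP => /orP ef; apply/eqP/mM => //.
by case: ef => /eqP ->; [left | right].
Qed.

Lemma card_rights_matching M : matching M -> #|rights M| = #|lefts M|.
Proof.
move/matchingP => mM.
rewrite /rights /lefts !card_in_imset // => e f eM fM ef.
- by apply: mM => //; left.
- by apply: mM => //; right.
Qed.

Lemma matching_setU1 M e :
  matching M -> e.1 \notin lefts M -> e.2 \notin rights M ->
  matching (e |: M).
Proof.
move=> /matchingP mM e1 e2; apply/matchingP => f g.
have new h : h \in M -> ~ (e.1 = h.1 \/ e.2 = h.2).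
  move=> hM [eh | eh].
  - by move: e1; rewrite eh in_lefts.
  - by move: e2; rewrite eh in_rights.
move=> /setU1P[-> | fM] /setU1P[-> | gM] // fg; last exact: mM.
- by case: (new g).
- by case: (new f) => //; case: fg; [left | right].
Qed.

Lemma setU1_setCU1 (T : finType) (a : T) (A : {set T}) :
  a \notin A -> a |: ~: (a |: A) = ~: A.
Proof.
by move=> aA; apply/setP => x; rewrite !inE; case: (eqVneq x a) => // ->.
Qed.

Lemma completable_setU1 G pi e :
  e \in G -> e.1 \notin lefts pi -> e.2 \notin rights pi ->
  completable G (e |: pi) -> completable G pi.
Proof.
move=> eG e1 e2 /existsP[M /and4P[sMG mM /eqP lM /eqP rM]].
apply/existsP; exists (e |: M); apply/and4P; split.
- by rewrite subUset sub1set eG.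
- apply: matching_setU1 => //.
  + by rewrite lM lefts_setU1 !inE eqxx.
  + by rewrite rM rights_setU1 !inE eqxx.
- by rewrite lefts_setU1 lM lefts_setU1 setU1_setCU1.
- by rewrite rights_setU1 rM rights_setU1 setU1_setCU1.
Qed.

Lemma completable_full G pi :
  lefts pi = setT -> rights pi = setT -> completable G pi.
Proof.
move=> lT rT; apply/existsP; exists set0; rewrite /perfect_matching lT rT.
rewrite sub0set /lefts /rights !imset0 setCT eqxx !andbT.
by apply/matchingP => e f; rewrite inE.
Qed.

(** What the algorithm guarantees of its state after [m] steps, completability
    aside. *)
Definition prefix_matching G m pi : Prop :=
  [/\ pi \subset G, matching pi & lefts pi = [set x : 'I_n | x < m]%N].

Lemma prefix_matching_setU1 G pi e :
  prefix_matching G e.1 pi -> e \in G -> e.2 \notin rights pi ->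
  prefix_matching G e.1.+1 (e |: pi).
Proof.
move=> [sG mpi lpi] eG e2; split.
- by rewrite subUset sub1set eG.
- by apply: matching_setU1; rewrite // lpi inE ltnn.
- rewrite lefts_setU1 lpi; apply/setP => x; rewrite !inE -val_eqE /=; lia.
Qed.

(** Pigeonhole: [v] right vertices are used, whereas [v + 1] right vertices
    do not exceed [v]. *)
Lemma prefix_matching_free_right G (v : 'I_n) pi :
  prefix_matching G v pi -> exists2 y : 'I_n, y \notin rights pi & (y <= v)%N.
Proof.
move=> [_ mpi lpi]; apply/exists_inP; apply/contraT; rewrite negb_exists_in.
move=> /forall_inP used.
have : [set x : 'I_n | x <= v]%N \subset rights pi.
  by apply/subsetP => y; rewrite inE; apply: contraLR => /used.
move/subset_leq_card; rewrite card_rights_matching // lpi.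
rewrite leqNgt proper_card //; apply/properP; split.
  by apply/subsetP => x; rewrite !inE => /ltnW.
by exists v; rewrite inE ?leqnn ?ltnn.
Qed.

End Matchings.

(** * Completability in the band graph *)

Section Band.
Variables s t n : nat.
Implicit Types (pi : {set edge n}) (x y v : 'I_n).
Local Notation G := (st_graph s t n).

Lemma in_st_graph x y :
  ((x, y) \in G) = (x <= y + s)%N && (y <= x + t)%N.
Proof. by rewrite inE /=; lia. Qed.

(** Induction on the number of left vertices still to be matched, each step
    matching the next one to the smallest free right vertex. *)
Lemma greedy_completable m pi :
  (m <= n)%N -> prefix_matching G m pi ->
  (forall y, y \notin rights pi -> m <= y + s)%N -> completable G pi.
Proof.
move: {2}(n - m)%N (erefl (n - m)%N) => d.
elim: d m pi => [|d IHd] m pi nm le_mn pre low.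
  have [_ mpi lpi] := pre.
  have lT : lefts pi = setT.
    by apply/setP => x; rewrite lpi !inE; have := ltn_ord x; lia.
  apply: completable_full => //; apply/eqP.
  by rewrite eqEcard subsetT card_rights_matching // lT leqnn.
have lt_mn : (m < n)%N by lia.
pose v := Ordinal lt_mn.
have [y0 free0 le_y0] := @prefix_matching_free_right _ _ v _ pre.
case: (@arg_minnP _ y0 (fun y => y \notin rights pi) val free0) => y free_y min_y.
have vy : (v, y) \in G.
  have le_yy0 : (y <= y0)%N := min_y y0 free0.
  rewrite in_st_graph (low y free_y) /=.
  apply: leq_trans le_yy0 _; apply: leq_trans le_y0 _; exact: leq_addr.
have lpi : lefts pi = [set x : 'I_n | x < m]%N by case: pre.
apply: (@completable_setU1 _ _ _ (v, y)) => //=.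
  by rewrite lpi inE ltnn.
apply: (IHd m.+1) => //; first by lia.
  exact: (@prefix_matching_setU1 _ _ _ (v, y)).
move=> z; rewrite rights_setU1 in_setU1 negb_or -val_eqE /= => /andP[zy free_z].
have le_yz : (y <= z)%N := min_y z free_z.
by have := low y free_y; lia.
Qed.

Lemma completableE m pi :
  (m <= n)%N -> prefix_matching G m pi ->
  completable G pi <-> (forall y, y \notin rights pi -> m <= y + s)%N.
Proof.
move=> le_mn pre; split=> [|low]; last exact: greedy_completable low.
have [_ _ lpi] := pre.
move=> /existsP[M /and4P[/subsetP sMG _ /eqP lM /eqP rM]] y.
rewrite -in_setC -rM => /imsetP[[x z] xzM /= ->].
have := in_lefts xzM; rewrite lM lpi !inE -leqNgt /= => le_mx.
by have := sMG _ xzM; rewrite in_st_graph => /andP[le_x _]; exact: leq_trans le_x.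
Qed.

(** The criterion for [v + 1] applied after adding [(v, k)]: the free right
    vertices that [v + 1] and its successors cannot reach, those with
    [y + s <= v], have to be used up by this one edge. *)
Lemma in_J v pi k :
  prefix_matching G v pi ->
  (v, k) \in J G pi v <->
  [/\ (v, k) \in G, k \notin rights pi &
      forall y, y != k -> y \notin rights pi -> (v < y + s)%N].
Proof.
move=> pre.
have U1 := @prefix_matching_setU1 _ G pi (v, k) pre.
have cE vkG kf := completableE (ltn_ord v) (U1 vkG kf).
split=> [|[vkG kf low]].
  rewrite in_set /= => /and4P[vkG _ kf /(cE vkG kf) low]; split=> // y yk yf.
  by apply: low; rewrite rights_setU1 in_setU1 negb_or yk.
rewrite in_set vkG eqxx kf /=; apply/(cE vkG kf) => y.
by rewrite rights_setU1 in_setU1 negb_or => /andP[]; exact: low.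
Qed.

(** * States reached by the algorithm *)

Lemma step_neq0 (mu : {ffun {set edge n} -> rat}) v pi' :
  step G mu v pi' != 0 ->
  exists pi e, [/\ mu pi != 0, e \in J G pi v & pi' = e |: pi].
Proof.
have nz (I : finType) (P : pred I) (F : I -> rat) :
    \sum_(i | P i) F i != 0 -> exists2 i, P i & F i != 0.
  move=> sum_nz; apply/exists_inP; apply: contraNT sum_nz.
  rewrite negb_exists_in => /forall_inP F0; apply/eqP/big1 => i /F0.
  by rewrite negbK => /eqP.
rewrite ffunE => /nz[pi _]; rewrite mulf_eq0 negb_or => /andP[mu_nz].
move=> /nz[e eJ]; case: (eqVneq pi' (e |: pi)) => [-> _ | _]; last first.
  by rewrite mul0r eqxx.
by exists pi, e.
Qed.

(** The start is the only state at which completability needs an argument, the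
    criterion for [m = 0] being void; later it is inherited from the
    definition of [J]. *)
Lemma top_down_law_support m pi :
  (m <= n)%N -> top_down_law G m pi != 0 ->
  prefix_matching G m pi /\ completable G pi.
Proof.
elim: m pi => [|m IHm] pi' le_mn.
  rewrite /top_down_law take0 /= ffunE.
  case: (eqVneq pi' set0) => [-> _ | _]; last by rewrite eqxx.
  have pre0 : prefix_matching G 0 set0.
    split; rewrite ?sub0set //.
      by apply/matchingP => e f; rewrite inE.
    by rewrite /lefts imset0; apply/setP => x; rewrite !inE.
  by split=> //; apply/(completableE _ pre0).
pose v := Ordinal le_mn.
rewrite /top_down_law (take_nth v) ?size_enum_ord // -cats1 foldl_cat /=.
rewrite (_ : nth v _ m = v); last by apply: val_inj; rewrite /= nth_enum_ord.
move=> /step_neq0[pi [e [mu_nz]]].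
rewrite in_set => /and4P[eG /eqP e1 e2 compl] ->; split=> //.
have [pre _] := IHm pi (ltnW le_mn) mu_nz.
by have := @prefix_matching_setU1 _ G pi e; rewrite e1; apply.
Qed.

End Band.

Theorem proposition1p2 (s t n : nat) (hs : (1 <= s)%N) (ht : (1 <= t)%N)
    (hn : (1 <= n)%N) (i : 'I_n) (pi : {set edge n})
    (hpi : 0 < top_down_law (st_graph s t n) i pi) :
  (forall k : 'I_n, (k + s = i)%N -> k \notin rights pi ->
     J_right (st_graph s t n) pi i = [set k]) /\
  (~ (exists2 k : 'I_n, (k + s = i)%N & k \notin rights pi) ->
     forall k : 'I_n, (i, k) \in st_graph s t n -> k \notin rights pi ->
       (i, k) \in J (st_graph s t n) pi i).
Proof.
have [pre compl] := top_down_law_support (ltnW (ltn_ord i)) (lt0r_neq0 hpi).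
have /(completableE (ltnW (ltn_ord i)) pre) low := compl.
split=> [k ki kf | none k ik kf].
  have ikJ : (i, k) \in J (st_graph s t n) pi i.
    apply/(in_J k pre); split=> //; first by rewrite in_st_graph; lia.
    by move=> y; rewrite -val_eqE /= => yk /low; lia.
  apply/setP => y; rewrite in_set1; apply/imsetP/eqP => [[[x z] xzJ /= ->] | ->].
    have xi : x = i by move: xzJ; rewrite in_set => /and3P[_ /eqP].
    move: xzJ; rewrite xi => /(in_J z pre)[_ _ others].
    apply/eqP; apply: contraT; rewrite eq_sym => kz.
    by have := others k kz kf; rewrite ki ltnn.
  by exists (i, k).
apply/(in_J k pre); split=> // y _ yf.
rewrite ltn_neqAle low // andbT; apply/eqP => iy.
by apply: none; exists y.
Qed.
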